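(* Let $I=(0,1)$ and let $\Omega\subset\mathbb R^d$ be a bounded Lipschitz domain. Let $\mathbf D=\mathbf D^\top\in\mathbb R^{d\times d}$ be positive definite and $c\ge 0$, and set $a(\eta,\zeta):=\int_\Omega \mathbf D\nabla\eta\cdot\nabla\zeta+c\,\eta\zeta\,\mathrm d\vec x$ for $\eta,\zeta\in H^1_0(\Omega)$. Fix $p_t,p_{\vec x}\in\mathbb N$, a partition $\mathcal T_I$ of $I$ into subintervals and a conforming triangulation $\mathcal T_\Omega$ of $\Omega$. Let $X_t:=H^1(I)\cap\mathbb P^{-1}_{p_t}(\mathcal T_I)$ with Lagrange basis $\Phi_t=(\varphi_1,\dots,\varphi_{N_t})$, $X_{\vec x}:=H^1_0(\Omega)\cap\mathbb P^{-1}_{p_{\vec x}}(\mathcal T_\Omega)$ with Lagrange basis $\Phi_{\vec x}=(\psi_1,\dots,\psi_{N_{\vec x}})$, and $Y_t:=\mathbb P^{-1}_{p_t}(\mathcal T_I)$ with an $L_2(I)$-orthogonal basis $\Xi=(\xi_1,\dots,\xi_{M_t})$. Put $X^\delta:=X_t\otimes X_{\vec x}$, $Y^\delta:=Y_t\otimes X_{\vec x}$, and for $w\in X^\delta$, $v\in Y^\delta$ let $(Bw)(v):=\int_I \langle \partial_t w(t),v(t)\rangle_{L_2(\Omega)}+a(w(t),v(t))\,\mathrm dt$. Let $\mathbf O_{ij}:=\int_I\xi_j\xi_i$, let $\mathbf K_{\vec x}\in\mathbb R^{N_{\vec x}\times N_{\vec x}}$ be symmetric positive definite, $\mathbf K_Y:=\mathbf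 O^{-1}\otimes\mathbf K_{\vec x}$, and define $K_Y^\delta:(Y^\delta)'\to Y^\delta$ by $K_Y^\delta\ell:=\sum_{(j,l),(j',l')}(\mathbf K_Y)_{(j,l),(j',l')}\,\ell(\xi_{j'}\otimes\psi_{l'})\,\xi_j\otimes\psi_l$. For $u,w\in X^\delta$ let $(S^\delta u)(w):=(Bw)\big(K_Y^\delta((Bu)|_{Y^\delta})\big)+\langle u(0),w(0)\rangle_{L_2(\Omega)}$, and let $\mathbf S_{(i,k),(i',k')}:=(S^\delta(\varphi_{i'}\otimes\psi_{k'}))(\varphi_i\otimes\psi_k)$. Define $(\mathbf L)_{ij}:=\int_I\varphi_j'\varphi_i$, $(\mathbf M_t)_{ij}:=\int_I\varphi_j\varphi_i$, $(\mathbf A_t)_{ij}:=\int_I\varphi_j'\varphi_i'$, $(\mathbf\Gamma_0)_{ij}:=\varphi_i(0)\varphi_j(0)$, $(\mathbf M_{\vec x})_{kl}:=\int_\Omega\psi_l\psi_k$ and $(\mathbf A_{\vec x})_{kl}:=\int_\Omega\mathbf D\nabla\psi_l\cdot\nabla\psi_k+c\,\psi_l\psi_k$. Then \[ \mathbf S=\mathbf A_t\otimes(\mathbf M_{\vec x}\mathbf K_{\vec x}\mathbf M_{\vec x})+\mathbf M_t\otimes(\mathbf A_{\vec x}\mathbf K_{\vec x}\mathbf A_{\vec x})+\mathbf L^\top\otimes(\mathbf M_{\vec x}\mathbf K_{\vec x}\mathbf A_{\vec x})+\mathbf L\otimes(\mathbf A_{\vec x}\mathbf K_{\vec x}\mathbf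 M_{\vec x})+\mathbf\Gamma_0\otimes\mathbf M_{\vec x}. \] In particular, $\mathbf S$ does not depend on the choice of $Y_t$ (among spaces containing $X_t$ and $\tfrac{\mathrm d}{\mathrm dt}X_t$) nor on the choice of its orthogonal basis $\Xi$.
   Context: $\mathbb P^{-1}_p(\mathcal T)$ denotes the space of (possibly discontinuous) piecewise polynomials of degree at most $p$ on the partition $\mathcal T$; note $X_t\subset Y_t$ and $\tfrac{\mathrm d}{\mathrm dt}X_t\subset Y_t$. Kronecker products use index pairs with the time index outer: $(\mathbf P\otimes\mathbf Q)_{(i,k),(j,l)}=\mathbf P_{ij}\mathbf Q_{kl}$. *)

(* Defs.v *)
From HB Require Import structures.
From mathcomp Require Import all_boot all_order all_algebra.
From mathcomp Require Import all_classical all_reals all_analysis.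
Set Implicit Arguments. Unset Strict Implicit. Unset Printing Implicit Defensive.
Import Order.TTheory GRing.Theory Num.Theory.
Import numFieldNormedType.Exports.
Local Open Scope classical_set_scope.
Local Open Scope ring_scope.

Definition intI {R : realType} (f : R -> R) : R :=
  \int[@lebesgue_measure R]_(t in `]0, 1[) f t.

Definition is_partition {R : realType} (n : nat) (tau : nat -> R) : Prop :=
  (0 < n)%N /\ tau 0%N = 0 /\ tau n = 1 /\
  forall k, (k < n)%N -> tau k < tau k.+1.

(* t lies in the interior of some subinterval (i.e. t in I, off the nodes);
   functions of P^{-1} are L2-classes, so they are compared off the nodes *)
Definition off_nodes {R : realType} (n : nat) (tau : nat -> R) (t : R) : Prop :=
  exists2 k, (k < n)%N & tau k < t < tau k.+1.

Definition in_Pdisc {R : realType} (n : nat) (tau : nat -> R) (p : nat)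
  (f : R -> R) : Prop :=
  forall k, (k < n)%N -> exists q : {poly R},
    (size q <= p.+1)%N /\ forall t, tau k < t < tau k.+1 -> f t = q.[t].

(* f in H^1(I) cap P^{-1}_p(T_I) (continuous representative on [0,1]) *)
Definition in_Xt {R : realType} (n : nat) (tau : nat -> R) (p : nat)
  (f : R -> R) : Prop :=
  in_Pdisc n tau p f /\ {within `[0, 1], continuous f}.

Definition basis_Xt {R : realType} (n : nat) (tau : nat -> R) (p : nat)
  (N : nat) (phi : 'I_N -> R -> R) : Prop :=
  (forall i, in_Xt n tau p (phi i)) /\
  (forall f, in_Xt n tau p f -> exists c : 'I_N -> R,
      forall t, 0 <= t <= 1 -> f t = \sum_i c i * phi i t) /\
  (forall c : 'I_N -> R,
      (forall t, 0 <= t <= 1 -> \sum_i c i * phi i t = 0) ->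
      forall i, c i = 0).

(* xi is an L2(I)-orthogonal basis of Y_t = P^{-1}_p(T_I)
   (span and independence understood as L2-classes, i.e. off the nodes) *)
Definition orth_basis_Yt {R : realType} (n : nat) (tau : nat -> R) (p : nat)
  (M : nat) (xi : 'I_M -> R -> R) : Prop :=
  (forall j, in_Pdisc n tau p (xi j)) /\
  (forall f, in_Pdisc n tau p f -> exists c : 'I_M -> R,
      forall t, off_nodes n tau t -> f t = \sum_j c j * xi j t) /\
  (forall c : 'I_M -> R,
      (forall t, off_nodes n tau t -> \sum_j c j * xi j t = 0) ->
      forall j, c j = 0) /\
  (forall j j', j != j' -> intI (fun t => xi j t * xi j' t) = 0).

Definition kron {R : ringType} {m n p q : nat}
  (P : 'M[R]_(m, n)) (Q : 'M[R]_(p, q)) : 'I_m * 'I_p -> 'I_n * 'I_q -> R :=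
  fun ik jl => P ik.1 jl.1 * Q ik.2 jl.2.

(* Elements of X^delta = X_t (x) X_x are  sum_(i,k) W i k phi_i (x) psi_k,
   elements of Y^delta = Y_t (x) X_x are sum_(j,l) V j l xi_j (x) psi_l;
   they are represented by their coefficient matrices. *)
Section SpaceTime.
Variables (R : realType) (E : lmodType R).
Variables (m a : E -> E -> R). (* m = <.,.>_{L2(Omega)}, a = the form a *)
Variables (Nt Mt Nx : nat).
Variables (phi : 'I_Nt -> R -> R) (xi : 'I_Mt -> R -> R) (psi : 'I_Nx -> E).

Definition Xval (W : 'M[R]_(Nt, Nx)) (t : R) : E :=
  \sum_i \sum_k (W i k * phi i t) *: psi k.
Definition Xdt (W : 'M[R]_(Nt, Nx)) (t : R) : E :=
  \sum_i \sum_k (W i k * derive1 (phi i) t) *: psi k.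
Definition Yval (V : 'M[R]_(Mt, Nx)) (t : R) : E :=
  \sum_j \sum_l (V j l * xi j t) *: psi l.

Definition Bform (W : 'M[R]_(Nt, Nx)) (V : 'M[R]_(Mt, Nx)) : R :=
  intI (fun t => m (Xdt W t) (Yval V t) + a (Xval W t) (Yval V t)).

Definition KYdelta (KY : 'I_Mt * 'I_Nx -> 'I_Mt * 'I_Nx -> R)
  (ell : 'M[R]_(Mt, Nx) -> R) : 'M[R]_(Mt, Nx) :=
  \matrix_(j, l) \sum_j' \sum_l' KY (j, l) (j', l') * ell (delta_mx j' l').

Definition Sdelta (KY : 'I_Mt * 'I_Nx -> 'I_Mt * 'I_Nx -> R)
  (U W : 'M[R]_(Nt, Nx)) : R :=
  Bform W (KYdelta KY (fun V => Bform U V)) + m (Xval U 0) (Xval W 0).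

Definition Smat (KY : 'I_Mt * 'I_Nx -> 'I_Mt * 'I_Nx -> R) :
  'I_Nt * 'I_Nx -> 'I_Nt * 'I_Nx -> R :=
  fun ik ik' => Sdelta KY (delta_mx ik'.1 ik'.2) (delta_mx ik.1 ik.2).

Definition Omat : 'M[R]_Mt := \matrix_(i, j) intI (fun t => xi j t * xi i t).
Definition Lmat : 'M[R]_Nt :=
  \matrix_(i, j) intI (fun t => derive1 (phi j) t * phi i t).
Definition Mtmat : 'M[R]_Nt := \matrix_(i, j) intI (fun t => phi j t * phi i t).
Definition Atmat : 'M[R]_Nt :=
  \matrix_(i, j) intI (fun t => derive1 (phi j) t * derive1 (phi i) t).
Definition Gamma0 : 'M[R]_Nt := \matrix_(i, j) (phi i 0 * phi j 0).
Definition Mxmat : 'M[R]_Nx := \matrix_(k, l) m (psi l) (psi k).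
Definition Axmat : 'M[R]_Nx := \matrix_(k, l) a (psi l) (psi k).

End SpaceTime.

Definition symmetric_bilinear {R : realType} {E : lmodType R}
  (b : E -> E -> R) : Prop :=
  (forall x y, b x y = b y x) /\
  (forall (r : R) x y z, b (r *: x + y) z = r * b x z + b y z).

Definition spd {R : realType} {N : nat} (K : 'M[R]_N) : Prop :=
  K^T = K /\ forall v : 'cV[R]_N, v != 0 -> 0 < (v^T *m K *m v) 0 0.

(* Main.v *)
Require Import Defs.
From HB Require Import structures.
From mathcomp Require Import all_boot all_order all_algebra.
From mathcomp Require Import all_classical all_reals all_analysis.
From mathcomp Require Import measurable_realfun ring.
Import Order.TTheory GRing.Theory Num.Theory.
Import numFieldNormedType.Exports.
Set Implicit Arguments. Unset Strict Implicit. Unset Printing Implicit Defensive.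
Local Open Scope ring_scope.

(* Testing w = phi_i (x) psi_k against v = xi_j (x) psi_l gives
   (Bw)(v) = Lh_ji (M_x)_kl + Nh_ji (A_x)_kl with the time moments
   Lh_ji = int phi_i' xi_j and Nh_ji = int phi_i xi_j, i.e. B = Lh^T (x) M_x +
   Nh^T (x) A_x.  Hence S = B (O^-1 (x) K_x) B^T + Gamma_0 (x) M_x, and the
   mixed-product rule splits the first term into four Kronecker products with
   time factors Lh^T O^-1 Lh, Nh^T O^-1 Nh, Lh^T O^-1 Nh and Nh^T O^-1 Lh.
   Since phi_i and phi_i' lie in Y_t, expanding f = sum_j c_j xi_j gives
   moments(f) = O c, so moments(f)^T O^-1 moments(g) = c^T moments(g) =
   int f g: the four time factors are A_t, M_t, L^T and L.  The Gram matrix O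
   is invertible because it is diagonal and no xi_j vanishes in L2(I). *)

Section IntegrableUnion.
Context d (T : measurableType d) (R : realType) (mu : {measure set T -> \bar R}).
Local Open Scope classical_set_scope.
Local Open Scope ereal_scope.

Lemma integrableU (A B : set T) (f : T -> \bar R) : measurable A -> measurable B ->
  mu.-integrable A f -> mu.-integrable B f -> mu.-integrable (A `|` B) f.
Proof.
move=> mA mB /integrableP[mfA iA] /integrableP[mfB iB].
have mBA : measurable (B `\` A) by exact: measurableD.
have mfBA : measurable_fun (B `\` A) f by apply: (measurable_funS mB _ mfB) => x [].
apply/integrableP; split; first exact/measurable_funU.
rewrite -[A `|` B]setD0 -(setDv A) -setUDr integral_setU //; last 2 first.
- by apply: measurableT_comp => //; exact/measurable_funU.
- by rewrite disj_set2E setDIK.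
apply: lte_add_pinfty => //; apply: le_lt_trans iB.
by apply: ge0_subset_integral => //; exact: measurableT_comp.
Qed.

Lemma integrable_bigsetU (K : nat) (A : nat -> set T) (f : T -> \bar R) :
  (forall k, measurable (A k)) -> (forall k, (k < K)%N -> mu.-integrable (A k) f) ->
  mu.-integrable (\big[setU/set0]_(k < K) A k) f.
Proof.
move=> mA; elim: K => [|K IH] iA; first by rewrite big_ord0; exact: integrable_set0.
rewrite big_ord_recr /=; apply: integrableU => //.
- by apply: bigsetU_measurable => k _.
- by apply: IH => k /ltnW; exact: iA.
- exact: iA.
Qed.

End IntegrableUnion.

Lemma derive1_poly_on (R : realType) (f : R -> R) (q : {poly R}) (x y t : R) :
  (forall s, x < s < y -> f s = q.[s]) -> x < t < y ->
  derive1 f t = (q^`()).[t].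
Proof.
move=> fq xty; rewrite derivE !derive1E; apply: near_eq_derive.
have : \forall s \near t, s \in `]x, y[ by apply: near_in_itvoo; rewrite in_itv.
by apply: filterS => s; rewrite in_itv /= => /fq.
Qed.

Section IntegralOverI.
Variable R : realType.

Lemma eq_intI (f g : R -> R) : f =1 g -> intI f = intI g.
Proof. by move=> fg; apply: eq_Rintegral => t _; exact: fg. Qed.

Lemma intI_mulC (f g : R -> R) :
  intI (fun t => f t * g t) = intI (fun t => g t * f t).
Proof. by apply: eq_intI => t; rewrite mulrC. Qed.

Lemma intI_gt0 (f : R -> R) (x y c : R) :
  (@lebesgue_measure R).-integrable `]0, 1[ (EFin \o f) ->
  (forall t, 0 < t < 1 -> 0 <= f t) -> 0 < c -> x < y ->
  (forall t, x < t < y -> 0 < t < 1 /\ c <= f t) -> 0 < intI f.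
Proof.
move=> fi f0 c0 xy xyf.
have xy01 : (`]x, y[ `<=` `]0, 1[)%classic.
  by move=> t; rewrite /= !in_itv /= => /xyf[].
have mf := measurable_int _ fi.
have : ((c * (y - x))%:E <= \int[lebesgue_measure]_(t in `]0%R, 1%R[) (f t)%:E)%E.
  apply: (@le_trans _ _ (\int[lebesgue_measure]_(t in `]x, y[) (f t)%:E)%E); last first.
    exact: ge0_subset_integral.
  apply: (@le_trans _ _ (\int[lebesgue_measure]_(t in `]x, y[) (cst c%:E) t)%E).
    by rewrite integral_cst // [X in (_ * X)%E]lebesgue_measure_itv /= lte_fin xy -EFinM.
  apply: ge0_le_integral => //.
  - by move=> t _; rewrite lee_fin ltW.
  - exact: measurable_funS mf.
  - by move=> t; rewrite /= in_itv /= => /xyf[_]; rewrite lee_fin.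
rewrite -(fineK (integrable_fin_num _ fi)) // lee_fin; apply: lt_le_trans.
by rewrite mulr_gt0 // subr_gt0.
Qed.

End IntegralOverI.

Section PiecewisePolynomial.
Variables (R : realType) (n : nat) (tau : nat -> R).
Local Notation mu := (@lebesgue_measure R).

Definition piecewise_poly (f : R -> R) := forall k, (k < n)%N ->
  exists q : {poly R}, forall t, tau k < t < tau k.+1 -> f t = q.[t].

Lemma in_Pdisc_piecewise_poly p f : in_Pdisc n tau p f -> piecewise_poly f.
Proof. by move=> fP k kn; have [q [_ fq]] := fP k kn; exists q. Qed.

Lemma in_Pdisc_derive p f : in_Pdisc n tau p f -> in_Pdisc n tau p (derive1 f).
Proof.
move=> fP k kn; have [q [szq fq]] := fP k kn.
exists q^`(); split; last by move=> t; exact: derive1_poly_on.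
have [->|q0] := eqVneq q 0; first by rewrite deriv0 size_poly0.
by apply: leq_trans szq; exact/ltnW/lt_size_deriv.
Qed.

Lemma piecewise_polyC c : piecewise_poly (fun=> c).
Proof. by move=> k _; exists c%:P => t _; rewrite hornerC. Qed.

Lemma piecewise_polyD f g : piecewise_poly f -> piecewise_poly g ->
  piecewise_poly (fun t => f t + g t).
Proof.
move=> fP gP k kn; have [p fp] := fP k kn; have [q gq] := gP k kn.
by exists (p + q) => t tk; rewrite hornerD fp ?gq.
Qed.

Lemma piecewise_polyM f g : piecewise_poly f -> piecewise_poly g ->
  piecewise_poly (fun t => f t * g t).
Proof.
move=> fP gP k kn; have [p fp] := fP k kn; have [q gq] := gP k kn.
by exists (p * q) => t tk; rewrite hornerM fp ?gq.
Qed.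

Lemma piecewise_polyZ c f : piecewise_poly f -> piecewise_poly (fun t => c * f t).
Proof. exact/piecewise_polyM/piecewise_polyC. Qed.

Lemma piecewise_poly_sum (I : Type) (r : seq I) (F : I -> R -> R) :
  (forall i, piecewise_poly (F i)) ->
  piecewise_poly (fun t => \sum_(i <- r) F i t).
Proof.
move=> FP; elim: r => [|i r IH].
  by under eq_fun do rewrite big_nil; exact: piecewise_polyC.
by under eq_fun do rewrite big_cons; exact: piecewise_polyD.
Qed.

Hypothesis tauP : is_partition n tau.

Lemma partition_le i j : (i <= j <= n)%N -> tau i <= tau j.
Proof.
case: tauP => _ [_ [_ tau_lt]] /andP[]; elim: j => [|j IH].
  by rewrite leqn0 => /eqP ->.
rewrite leq_eqVlt => /orP[/eqP -> //|ij] jn.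
by apply: le_trans (IH ij (ltnW jn)) _; exact/ltW/tau_lt.
Qed.

Lemma partition_cover t : 0 < t < 1 ->
  exists2 k, (k < n)%N & tau k <= t < tau k.+1.
Proof.
case: tauP => _ [tau0 [taun _]] /andP[t0 t1].
suff : forall K, (K <= n)%N -> t < tau K ->
    exists2 k, (k < K)%N & tau k <= t < tau k.+1.
  by apply; rewrite ?taun.
elim=> [|K IH] Kn tK; first by move: (lt_trans t0 tK); rewrite tau0 ltxx.
have [tK'|tK'] := ltP t (tau K); last by exists K; rewrite ?tK'.
by have [k kK tk] := IH (ltnW Kn) tK'; exists k => //; exact: ltnW.
Qed.

Lemma off_nodes_itv t : off_nodes n tau t -> 0 < t < 1.
Proof.
case: tauP => _ [tau0 [taun _]] [k kn /andP[kt tk]]; apply/andP; split.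
  by apply: le_lt_trans kt; rewrite -tau0; apply: partition_le; exact: ltnW.
by apply: lt_le_trans tk _; rewrite -taun; apply: partition_le; rewrite kn /=.
Qed.

Lemma piecewise_poly_integrable f : piecewise_poly f ->
  mu.-integrable `]0, 1[ (EFin \o f).
Proof.
move=> fP.
pose piece k : set (measurableTypeR R) := (`]tau k, tau k.+1[ `|` [set tau k])%classic.
have mpiece k : measurable (piece k) by apply: measurableU.
apply: (@integrableS _ _ _ mu (\big[setU/set0]_(k < n) piece k)%classic).
- by apply: bigsetU_measurable => k _.
- by [].
- move=> t /=; rewrite in_itv /= => /partition_cover[k kn ktk].
  rewrite -bigcup_seq; exists (Ordinal kn); first by rewrite /= mem_index_enum.
  move: ktk; rewrite le_eqVlt => /andP[/predU1P[<-|kt] tk]; first by right.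
  by left; rewrite /= in_itv /= kt.
apply: integrable_bigsetU => // k kn; apply: integrableU => //.
  have [q fq] := fP k kn.
  apply: (@eq_integrable _ _ _ mu _ _ (EFin \o horner q)) => //.
    by move=> t; rewrite inE /= in_itv /= => /fq ->.
  have := @continuous_compact_integrable R (horner q) `[tau k, tau k.+1]
    (@segment_compact R _ _) (continuous_subspaceT (@continuous_horner R q)).
  by apply: integrableS => //; exact: subset_itvW.
apply: null_set_integrable => //; first exact: measurable_fun_set1.
exact: lebesgue_measure_set1.
Qed.

Lemma intID f g : piecewise_poly f -> piecewise_poly g ->
  intI (fun t => f t + g t) = intI f + intI g.
Proof. by move=> fP gP; rewrite /intI RintegralD //; exact: piecewise_poly_integrable. Qed.

Lemma intIZl c f : piecewise_poly f -> intI (fun t => c * f t) = c * intI f.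
Proof. by move=> fP; rewrite /intI RintegralZl //; exact: piecewise_poly_integrable. Qed.

Lemma intI_sum (I : Type) (r : seq I) (F : I -> R -> R) :
  (forall i, piecewise_poly (F i)) ->
  intI (fun t => \sum_(i <- r) F i t) = \sum_(i <- r) intI (F i).
Proof.
move=> FP; elim: r => [|i r IH].
  rewrite big_nil /intI; under eq_Rintegral do rewrite big_nil.
  by rewrite Rintegral_cst // mul0r.
rewrite big_cons -IH -intID //; last exact: piecewise_poly_sum.
by apply: eq_intI => t; rewrite big_cons.
Qed.

(* The nodes form a countable, hence Lebesgue-null, set. *)
Lemma eq_intI_off_nodes f g : piecewise_poly f -> piecewise_poly g ->
  (forall t, off_nodes n tau t -> f t = g t) -> intI f = intI g.
Proof.
move=> fP gP fg; rewrite /intI /Rintegral; congr fine.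
apply: ae_eq_integral => //.
- exact: measurable_int (piecewise_poly_integrable fP).
- exact: measurable_int (piecewise_poly_integrable gP).
exists (range tau); split.
- apply: countable_measurable; [move=> ?; exact: measurable_set1 | exact: card_image_le].
- exact/countable_lebesgue_measure0/card_image_le.
move=> t /= /not_implyP[]; rewrite in_itv /= => /partition_cover[k kn].
rewrite le_eqVlt => /andP[/predU1P[<-|kt] tk] fgt; first by exists k.
by exfalso; apply: fgt; rewrite fg //; exists k; rewrite ?kt.
Qed.

Lemma intI_sqr_gt0 f t0 : piecewise_poly f -> off_nodes n tau t0 ->
  f t0 != 0 -> 0 < intI (fun t => f t * f t).
Proof.
move=> fP [k kn kt0] ft0; have [q fq] := fP k kn.
have q2t0 : 0 < q.[t0] * q.[t0] by rewrite -expr2 exprn_even_gt0 //= -fq.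
pose c := q.[t0] * q.[t0] / 2.
have c0 : 0 < c by rewrite divr_gt0.
have : \forall t \near t0, tau k < t < tau k.+1 /\ c < q.[t] * q.[t].
  have t0k : t0 \in `]tau k, tau k.+1[ by rewrite in_itv.
  near=> t; split.
    by near: t; apply: filterS (near_in_itvoo t0k) => t; rewrite in_itv.
  rewrite -hornerM; near: t; apply: (cvgr_gt (f := horner (q * q))).
    exact: continuous_horner.
  by rewrite hornerM ltr_pdivrMr // ltr_pMr ?ltr1n.
move=> /nbhs_ballP[e /= e0 near_t0].
apply: (@intI_gt0 _ _ (t0 - e) (t0 + e) c).
- exact (piecewise_poly_integrable (piecewise_polyM fP fP)).
- by move=> t _; rewrite -expr2 sqr_ge0.
- exact: c0.
- by rewrite ltrBlDr -addrA ltrDl addr_gt0.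
move=> t te; have [tk ct] : tau k < t < tau k.+1 /\ c < q.[t] * q.[t].
  by apply: near_t0; rewrite ball_itv /= in_itv.
by split; [apply: off_nodes_itv; exists k | rewrite fq // ltW].
Unshelve. all: by end_near.
Qed.

End PiecewisePolynomial.

Section KroneckerForm.
Variable R : comNzRingType.

Lemma sum_delta_mx (V : zmodType) a b (i0 : 'I_a) (k0 : 'I_b)
    (F : 'I_a -> 'I_b -> R -> V) : (forall i k, F i k 0 = 0) ->
  \sum_i \sum_k F i k (delta_mx i0 k0 i k) = F i0 k0 1.
Proof.
move=> F0; rewrite (bigD1 i0) //= (bigD1 k0) //= mxE !eqxx /=.
rewrite big1 => [|k /negbTE k0k]; last by rewrite mxE eqxx k0k F0.
rewrite addr0 big1 ?addr0 // => i /negbTE i0i.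
by rewrite big1 // => k _; rewrite mxE i0i F0.
Qed.

Lemma mulmx3E m n p q (A : 'M[R]_(m, n)) (B : 'M[R]_(n, p)) (C : 'M[R]_(p, q)) i k :
  (A *m B *m C) i k = \sum_j \sum_j' A i j * B j j' * C j' k.
Proof.
rewrite mxE exchange_big; apply: eq_bigr => j' _.
by rewrite mxE mulr_suml.
Qed.

Definition pair_form a b c d (K : 'I_a * 'I_b -> 'I_c * 'I_d -> R)
    (X : 'I_a * 'I_b -> R) (Y : 'I_c * 'I_d -> R) : R :=
  \sum_j \sum_l (\sum_j' \sum_l' K (j, l) (j', l') * Y (j', l')) * X (j, l).

Lemma pair_formDl a b c d (K : 'I_a * 'I_b -> 'I_c * 'I_d -> R) X1 X2 Y :
  pair_form K (fun p => X1 p + X2 p) Y = pair_form K X1 Y + pair_form K X2 Y.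
Proof.
rewrite /pair_form -big_split; apply: eq_bigr => j _.
by rewrite -big_split; apply: eq_bigr => l _; rewrite mulrDr.
Qed.

Lemma pair_formDr a b c d (K : 'I_a * 'I_b -> 'I_c * 'I_d -> R) X Y1 Y2 :
  pair_form K X (fun p => Y1 p + Y2 p) = pair_form K X Y1 + pair_form K X Y2.
Proof.
rewrite /pair_form -big_split; apply: eq_bigr => j _.
rewrite -big_split; apply: eq_bigr => l _; rewrite /= -mulrDl -big_split /=.
by congr (_ * _); apply: eq_bigr => j' _; rewrite -big_split; apply: eq_bigr => l' _; rewrite mulrDr.
Qed.

Lemma pair_form_kron a b c d e f a' c' (P : 'M[R]_(a, b)) (Q : 'M[R]_(c, d))
    (O : 'M[R]_(b, e)) (K : 'M[R]_(d, f)) (P' : 'M[R]_(a', e)) (Q' : 'M[R]_(c', f))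
    ik ik' :
  pair_form (kron O K) (kron P Q ik) (kron P' Q' ik') =
  kron (P *m O *m P'^T) (Q *m K *m Q'^T) ik ik'.
Proof.
rewrite /pair_form /kron !mulmx3E [RHS]mulr_suml; apply: eq_bigr => j _.
rewrite [RHS]mulr_suml; under [RHS]eq_bigr do rewrite mulr_sumr.
rewrite [RHS]exchange_big; apply: eq_bigr => l _.
rewrite mulr_suml; apply: eq_bigr => j' _.
rewrite !mulr_suml mulr_sumr; apply: eq_bigr => l' _.
by rewrite !mxE /=; ring.
Qed.

End KroneckerForm.

Section SymmetricBilinear.
Variables (R : realType) (E : lmodType R) (b : E -> E -> R).
Hypothesis bP : symmetric_bilinear b.

Lemma bilin0l z : b 0 z = 0.
Proof.
have := bP.2 1 0 0 z; rewrite scale1r addr0 mul1r => b0.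
by apply: (@addrI _ (b 0 z)); rewrite addr0 -b0.
Qed.

Lemma bilinDl x y z : b (x + y) z = b x z + b y z.
Proof. by have := bP.2 1 x y z; rewrite scale1r mul1r. Qed.

Lemma bilinZl r x z : b (r *: x) z = r * b x z.
Proof. by have := bP.2 r x 0 z; rewrite addr0 bilin0l addr0. Qed.

Lemma bilinZr r x z : b z (r *: x) = r * b z x.
Proof. by rewrite bP.1 bilinZl bP.1. Qed.

Lemma bilin_sumr I (r : seq I) (F : I -> E) z :
  b z (\sum_(i <- r) F i) = \sum_(i <- r) b z (F i).
Proof.
rewrite bP.1; elim/big_rec2: _ => [|i y1 y2 _ <-]; first exact: bilin0l.
by rewrite bilinDl bP.1.
Qed.

Lemma Mxmat_tr N (psi : 'I_N -> E) : (Mxmat b psi)^T = Mxmat b psi.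
Proof. by apply/matrixP => k l; rewrite !mxE bP.1. Qed.

End SymmetricBilinear.

Section OrthogonalBasis.
Variables (R : realType) (n : nat) (tau : nat -> R) (p Mt : nat).
Variable xi : 'I_Mt -> R -> R.
Hypotheses (tauP : is_partition n tau) (xiP : orth_basis_Yt n tau p xi).

Definition moments N (f : 'I_N -> R -> R) : 'M[R]_(Mt, N) :=
  \matrix_(j, i) intI (fun t => f i t * xi j t).

Let xi_pw j : piecewise_poly n tau (xi j) := in_Pdisc_piecewise_poly (xiP.1 j).

Lemma orth_basis_elem_neq0 j : exists2 t, off_nodes n tau t & xi j t != 0.
Proof.
have [//|xi0] := pselect (exists2 t, off_nodes n tau t & xi j t != 0).
have sum_xi0 t : off_nodes n tau t -> \sum_j' (j' == j)%:R * xi j' t = 0.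
  move=> tP; rewrite (bigD1 j) //= eqxx mul1r big1 => [|j' /negbTE ->]; last first.
    by rewrite mul0r.
  by rewrite addr0; case: (eqVneq (xi j t) 0) => // xjt; case: xi0; exists t.
by have /eqP := xiP.2.2.1 _ sum_xi0 j; rewrite eqxx oner_eq0.
Qed.

Lemma Omat_tr : (Omat xi)^T = Omat xi.
Proof. by apply/matrixP => i j; rewrite !mxE intI_mulC. Qed.

Lemma Omat_unit : Omat xi \in unitmx.
Proof.
have -> : Omat xi = diag_mx (\row_j Omat xi j j).
  apply/matrixP => i j; rewrite !mxE; have [->|ij] := eqVneq i j; first by rewrite mulr1n.
  by rewrite mulr0n xiP.2.2.2 // eq_sym.
rewrite unitmxE det_diag unitfE; apply/prodf_neq0 => j _; rewrite !mxE.
have [t tP xjt] := orth_basis_elem_neq0 j.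
exact/lt0r_neq0/(intI_sqr_gt0 tauP (xi_pw j) tP xjt).
Qed.

Lemma intI_span (c : 'I_Mt -> R) f h : piecewise_poly n tau f ->
  piecewise_poly n tau h -> (forall t, off_nodes n tau t -> f t = \sum_j c j * xi j t) ->
  intI (fun t => f t * h t) = \sum_j c j * intI (fun t => xi j t * h t).
Proof.
move=> fP hP fc.
have xih j : piecewise_poly n tau (fun t => xi j t * h t) by exact: piecewise_polyM.
rewrite (@eq_intI_off_nodes _ _ _ tauP _ (fun t => \sum_j c j * (xi j t * h t))).
- rewrite (intI_sum tauP) => [|j]; last exact: piecewise_polyZ.
  by apply: eq_bigr => j _; rewrite (intIZl tauP).
- exact: piecewise_polyM.
- by apply: piecewise_poly_sum => j; exact: piecewise_polyZ.
by move=> t tP; rewrite fc // mulr_suml; apply: eq_bigr => j _; rewrite mulrA.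
Qed.

(* Only f needs to lie in span xi: moments f = O c, so (moments f)^T O^-1 = c^T. *)
Lemma moments_gram N N' (f : 'I_N -> R -> R) (g : 'I_N' -> R -> R) :
  (forall i, in_Pdisc n tau p (f i)) -> (forall i', piecewise_poly n tau (g i')) ->
  (moments f)^T *m invmx (Omat xi) *m moments g =
  \matrix_(i, i') intI (fun t => g i' t * f i t).
Proof.
move=> fP gP.
have /fin_all_exists[c fc] i := xiP.2.1 _ (fP i).
have -> : moments f = Omat xi *m \matrix_(j, i) c i j.
  apply/matrixP => j i.
  rewrite mxE (intI_span (in_Pdisc_piecewise_poly (fP i)) (xi_pw j) (fc i)) mxE.
  by apply: eq_bigr => j' _; rewrite !mxE mulrC.
rewrite trmx_mul Omat_tr -!mulmxA (mulmxA (Omat xi)) (mulmxV Omat_unit) mul1mx.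
apply/matrixP => i i'; rewrite !mxE intI_mulC.
rewrite (intI_span (in_Pdisc_piecewise_poly (fP i)) (gP i') (fc i)).
by apply: eq_bigr => j _; rewrite !mxE intI_mulC.
Qed.

End OrthogonalBasis.

Section SpaceTime.
Variables (R : realType) (E : lmodType R) (m a : E -> E -> R).
Variables (n : nat) (tau : nat -> R) (p Nt Mt Nx : nat).
Variables (phi : 'I_Nt -> R -> R) (xi : 'I_Mt -> R -> R) (psi : 'I_Nx -> E).
Hypotheses (mP : symmetric_bilinear m) (aP : symmetric_bilinear a).
Hypotheses (tauP : is_partition n tau) (phiP : forall i, in_Pdisc n tau p (phi i)).
Hypothesis xiP : forall j, piecewise_poly n tau (xi j).

Definition Bentry (ik : 'I_Nt * 'I_Nx) (jl : 'I_Mt * 'I_Nx) : R :=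
  kron (moments xi (fun i => derive1 (phi i)))^T (Mxmat m psi) ik jl
  + kron (moments xi phi)^T (Axmat a psi) ik jl.

Lemma Xval_delta i k t : Xval phi psi (delta_mx i k) t = phi i t *: psi k.
Proof.
rewrite /Xval (sum_delta_mx i k (F := fun i k d => (d * phi i t) *: psi k)) ?mul1r //.
by move=> *; rewrite mul0r scale0r.
Qed.

Lemma Xdt_delta i k t : Xdt phi psi (delta_mx i k) t = derive1 (phi i) t *: psi k.
Proof.
rewrite /Xdt (sum_delta_mx i k (F := fun i k d => (d * derive1 (phi i) t) *: psi k)).
  by rewrite mul1r.
by move=> *; rewrite mul0r scale0r.
Qed.

Lemma Bform_delta i k V : Bform m a phi xi psi (delta_mx i k) V =
  \sum_j \sum_l V j l * Bentry (i, k) (j, l).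
Proof.
have phi_pw := in_Pdisc_piecewise_poly (phiP i).
have dphi_pw := in_Pdisc_piecewise_poly (in_Pdisc_derive (phiP i)).
rewrite /Bform (@eq_intI _ _ (fun t => \sum_j \sum_l
    ((V j l * m (psi l) (psi k)) * (derive1 (phi i) t * xi j t)
   + (V j l * a (psi l) (psi k)) * (phi i t * xi j t)))); last first.
  move=> t; rewrite Xdt_delta Xval_delta /Yval (bilinZl mP) (bilinZl aP).
  rewrite (bilin_sumr mP) (bilin_sumr aP) !mulr_sumr -big_split; apply: eq_bigr => j _.
  rewrite (bilin_sumr mP) (bilin_sumr aP) !mulr_sumr -big_split; apply: eq_bigr => l _.
  by rewrite (bilinZr mP) (bilinZr aP) (mP.1 (psi k)) (aP.1 (psi k)) /=; ring.
have term_pw j l : piecewise_poly n tau (fun t =>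
    (V j l * m (psi l) (psi k)) * (derive1 (phi i) t * xi j t)
  + (V j l * a (psi l) (psi k)) * (phi i t * xi j t)).
  by apply: piecewise_polyD; apply: piecewise_polyZ; exact: piecewise_polyM.
rewrite (intI_sum tauP) => [|j]; last exact: piecewise_poly_sum.
apply: eq_bigr => j _; rewrite (intI_sum tauP) //; apply: eq_bigr => l _.
rewrite (intID tauP) ?(intIZl tauP); try by apply: piecewise_polyZ; exact: piecewise_polyM.
  by rewrite /Bentry /kron !mxE /=; ring.
all: exact: piecewise_polyM.
Qed.

Lemma Smat_pair_form KY ik ik' : Smat m a phi xi psi KY ik ik' =
  pair_form KY (Bentry ik) (Bentry ik') + kron (Gamma0 phi) (Mxmat m psi) ik ik'.
Proof.
case: ik ik' => [i k] [i' k'].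
rewrite /Smat /Sdelta /= Bform_delta !Xval_delta (bilinZl mP) (bilinZr mP) /kron !mxE /=.
congr (_ + _); last ring.
apply: eq_bigr => j _; apply: eq_bigr => l _; rewrite mxE; congr (_ * _).
apply: eq_bigr => j' _; apply: eq_bigr => l' _; rewrite Bform_delta.
rewrite (sum_delta_mx j' l' (F := fun j l d => d * Bentry (i', k') (j, l))) ?mul1r //.
by move=> *; rewrite mul0r.
Qed.

End SpaceTime.

Unset Implicit Arguments.

Theorem mainTheorem2 (R : realType) (E : lmodType R) (m a : E -> E -> R)
  (n : nat) (tau : nat -> R) (pt : nat)
  (Nt Mt Nx : nat) (phi : 'I_Nt -> R -> R) (xi : 'I_Mt -> R -> R)
  (psi : 'I_Nx -> E) (Kx : 'M[R]_Nx) :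
  symmetric_bilinear m -> symmetric_bilinear a ->
  is_partition n tau ->
  basis_Xt n tau pt phi ->
  orth_basis_Yt n tau pt xi ->
  spd Kx ->
  let KY := kron (invmx (Omat xi)) Kx in
  let Mx := Mxmat m psi in
  let Ax := Axmat a psi in
  forall ik ik' : 'I_Nt * 'I_Nx,
    Smat m a phi xi psi KY ik ik' =
      kron (Atmat phi) (Mx *m Kx *m Mx) ik ik'
    + kron (Mtmat phi) (Ax *m Kx *m Ax) ik ik'
    + kron (Lmat phi)^T (Mx *m Kx *m Ax) ik ik'
    + kron (Lmat phi) (Ax *m Kx *m Mx) ik ik'
    + kron (Gamma0 phi) Mx ik ik'.
Proof.
move=> mP aP tauP phiP xiP _ KY Mx Ax ik ik'.
have phi_in i : in_Pdisc n tau pt (phi i) := (phiP.1 i).1.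
have dphi_in i := in_Pdisc_derive (phi_in i).
have phi_pw i := in_Pdisc_piecewise_poly (phi_in i).
have dphi_pw i := in_Pdisc_piecewise_poly (dphi_in i).
have xi_pw j := in_Pdisc_piecewise_poly (xiP.1 j).
set Lh := moments xi (fun i => derive1 (phi i)); set Nh := moments xi phi.
set Oi := invmx (Omat xi).
have gram_At : Lh^T *m Oi *m Lh = Atmat phi := moments_gram tauP xiP dphi_in dphi_pw.
have gram_Mt : Nh^T *m Oi *m Nh = Mtmat phi := moments_gram tauP xiP phi_in phi_pw.
have gram_L : Nh^T *m Oi *m Lh = Lmat phi := moments_gram tauP xiP phi_in dphi_pw.
have gram_LT : Lh^T *m Oi *m Nh = (Lmat phi)^T.
  by rewrite (moments_gram tauP xiP dphi_in phi_pw); apply/matrixP => i i'; rewrite !mxE intI_mulC.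
have Mx_tr : Mx^T = Mx := Mxmat_tr mP psi.
have Ax_tr : Ax^T = Ax := Mxmat_tr aP psi.
rewrite (Smat_pair_form psi mP aP tauP phi_in xi_pw) /Bentry.
rewrite pair_formDl !pair_formDr !pair_form_kron !trmxK Mx_tr Ax_tr.
rewrite gram_At gram_Mt gram_L gram_LT; ring.
Qed.
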